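(* The two-stage representative selection problem with two-stage discrete budgeted uncertainty and with $|T_j|=2$ for all $j\in[\ell]$, $\Gamma=1$, $\underline{c}=\underline{d}$ and $\overline{c}=\overline{d}$ can be solved in $O(n^3)$ time.
   Context: Notation: $[n]=\{1,\dots,n\}$, $\min\emptyset=\infty$. Representative selection: $\mathcal{X}_{\rm nom}=\{x\in\{0,1\}^n:\sum_{i\in T_j}x_i=1,\ j\in[\ell]\}$ for a partition $T_1\cup\dots\cup T_\ell=[n]$. Put $\mathcal{X}=\{0,1\}^n$ and $\mathcal{X}(x)=\{y\in\{0,1\}^n: x+y\le\mathbf{1},\ x+y\in\mathcal{X}_{\rm nom}\}$. Two-stage discrete budgeted uncertainty: given vectors with $0\le\underline{c}_i\le\overline{c}_i$, $0\le\underline{d}_i\le\overline{d}_i$ ($i\in[n]$) and an integer $\Gamma\ge0$, $$\mathcal{U}=\{c\in\mathbb{R}^n_+: c_i=\underline{c}_i+(\overline{c}_i-\underline{c}_i)\delta_i,\ \delta_i\in\{0,1\}\ \forall i\in[n],\ \textstyle\sum_{i}\delta_i\le\Gamma\},$$ $$\mathcal{U}(c)=\{d\in\mathbb{R}^n_+: d_i=\underline{d}_i+(\overline{d}_i-\underline{d}_i)\delta_i,\ \delta_i\in\{0,1\}\ \forall i\in[n],\ \textstyle\sum_i\delta_i\le\Gamma-\sum_{i}\frac{c_i-\underline{c}_i}{\overline{c}_i-\underline{c}_i}\},$$ where a fraction with $\overline{c}_i=\underline{c}_i$ is read as $0$. The two-stage problem is to compute $$\textsc{Rob}=\min_{x\in\mathcal{X}}\max_{c\in\mathcal{U}}\min_{y\in\mathcal{X}(x)}\max_{d\in\mathcal{U}(c)}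 c^tx+d^ty .$$ *)

(* Defs.v *)
From mathcomp Require Import all_boot all_order all_algebra.
From mathcomp Require Import boolp classical_sets reals constructive_ereal ereal.

Set Implicit Arguments.
Unset Strict Implicit.
Unset Printing Implicit Defensive.

Import Order.TTheory GRing.Theory Num.Theory.

Local Open Scope classical_set_scope.
Local Open Scope ring_scope.

(** * Two-stage representative selection *)

(* Items are the elements of 'I_n and parts the elements of 'I_l, both
   numbered from 0. *)
Record instance (R : realType) (n l : nat) := Instance {
  part : 'I_l -> {set 'I_n};
  c_lo : 'rV[R]_n;
  c_up : 'rV[R]_n;
  d_lo : 'rV[R]_n;
  d_up : 'rV[R]_n;
  Gamma : nat }.

Section Problem.
Context {R : realType} {n l : nat}.
Implicit Types (I : instance R n l) (x y c d delta : 'rV[R]_n).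

(* [injective] is needed because the image set forgets the indexing: without
   it, two indices could carry the same part. *)
Definition well_formed I : Prop :=
  [/\ finset.partition (part I @: [set: 'I_l]%SET)%SET [set: 'I_n]%SET,
      injective (part I),
      forall i, 0 <= c_lo I 0 i <= c_up I 0 i
    & forall i, 0 <= d_lo I 0 i <= d_up I 0 i].

Definition binary : set 'rV[R]_n :=
  [set x | forall i, x 0 i = 0 \/ x 0 i = 1].

Definition X_nom I : set 'rV[R]_n :=
  [set x | binary x /\ forall j, \sum_(i in part I j) x 0 i = 1].

Definition X_second I x : set 'rV[R]_n :=
  [set y | [/\ binary y, forall i, (x + y) 0 i <= 1 & X_nom I (x + y)]].

Definition U_first I : set 'rV[R]_n :=
  [set c | (forall i, 0 <= c 0 i) /\
     exists delta, [/\ binary delta,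
       forall i, c 0 i = c_lo I 0 i + (c_up I 0 i - c_lo I 0 i) * delta 0 i
     & \sum_i delta 0 i <= (Gamma I)%:R]].

(* A fraction with zero denominator is 0, since 0^-1 = 0 in a field. *)
Definition U_second I c : set 'rV[R]_n :=
  [set d | (forall i, 0 <= d 0 i) /\
     exists delta, [/\ binary delta,
       forall i, d 0 i = d_lo I 0 i + (d_up I 0 i - d_lo I 0 i) * delta 0 i
     & \sum_i delta 0 i <=
         (Gamma I)%:R
         - \sum_i (c 0 i - c_lo I 0 i) / (c_up I 0 i - c_lo I 0 i)]].

Definition cost c d x y : R :=
  \sum_i c 0 i * x 0 i + \sum_i d 0 i * y 0 i.

(* All the sets involved are finite, so each infimum (resp. supremum) over a
   nonempty set is a minimum (resp. maximum).  Only X_second I x can be empty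
   in a well-formed instance, and ereal_inf set0 = +oo. *)
Definition Rob I : \bar R :=
  ereal_inf [set ereal_sup [set ereal_inf [set ereal_sup
    [set (cost c d x y)%:E
       | d in U_second I c]
       | y in X_second I x]
       | c in U_first I]
       | x in binary].

End Problem.

(** * Computation model and running time *)

(* A random access machine with real numbers, presented as a structured
   language.  Memory consists of arrays of natural numbers and arrays of
   reals, each array being designated by a fixed name (a number occurring in
   the program), so that a program only uses finitely many arrays; a scalar
   variable is an array of which only one cell is used.  Only natural numbers
   can serve as indices.  The operations are addition, subtraction and
   comparison, each at unit cost.  There is neither multiplication nor
   division nor rounding, so the language is a fragment of the usual real RAM
   and time upper bounds carry over to the latter. *)
Inductive iexp : Type :=
| IConst (k : nat)
| IGet (a : nat) (idx : iexp)
| IAdd (e1 e2 : iexp)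
| ISub (e1 e2 : iexp).

Inductive rexp : Type :=
| RConst (k : nat)
| RGet (a : nat) (idx : iexp)
| RAdd (e1 e2 : rexp)
| RSub (e1 e2 : rexp).

Inductive test : Type :=
| ILe (e1 e2 : iexp)
| RLe (e1 e2 : rexp)
| Not (b : test)
| And (b1 b2 : test).

Inductive cmd : Type :=
| Skip
| ISet (a : nat) (idx e : iexp)
| RSet (a : nat) (idx : iexp) (e : rexp)
| Seq (p q : cmd)
| If (b : test) (p q : cmd)
| While (b : test) (p : cmd).

Fixpoint itime (e : iexp) : nat :=
  match e with
  | IConst _ => 1
  | IGet _ e => (itime e).+1
  | IAdd e1 e2 | ISub e1 e2 => (itime e1 + itime e2).+1
  end.

Fixpoint rtime (e : rexp) : nat :=
  match e with
  | RConst _ => 1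
  | RGet _ e => (itime e).+1
  | RAdd e1 e2 | RSub e1 e2 => (rtime e1 + rtime e2).+1
  end.

Fixpoint ttime (b : test) : nat :=
  match b with
  | ILe e1 e2 => (itime e1 + itime e2).+1
  | RLe e1 e2 => (rtime e1 + rtime e2).+1
  | Not b => (ttime b).+1
  | And b1 b2 => (ttime b1 + ttime b2).+1
  end.

Record state (R : realType) := State {
  imem : nat -> nat -> nat;
  rmem : nat -> nat -> R }.

Definition update (V : Type) (m : nat -> nat -> V) (a k : nat) (v : V) :
    nat -> nat -> V :=
  fun a' k' => if (a' == a) && (k' == k) then v else m a' k'.

Section Semantics.
Context {R : realType}.
Implicit Types s : state R.

(* Subtraction of natural numbers is truncated. *)
Fixpoint ieval s (e : iexp) : nat :=
  match e with
  | IConst k => k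
  | IGet a e => imem s a (ieval s e)
  | IAdd e1 e2 => (ieval s e1 + ieval s e2)%N
  | ISub e1 e2 => (ieval s e1 - ieval s e2)%N
  end.

Fixpoint reval s (e : rexp) : R :=
  match e with
  | RConst k => k%:R
  | RGet a e => rmem s a (ieval s e)
  | RAdd e1 e2 => reval s e1 + reval s e2
  | RSub e1 e2 => reval s e1 - reval s e2
  end.

Fixpoint teval s (b : test) : bool :=
  match b with
  | ILe e1 e2 => (ieval s e1 <= ieval s e2)%N
  | RLe e1 e2 => reval s e1 <= reval s e2
  | Not b => ~~ teval s b
  | And b1 b2 => teval s b1 && teval s b2
  end.

(* [exec p s s' t]: started in s, the program p halts in s' after t steps. *)
Inductive exec : cmd -> state R -> state R -> nat -> Prop :=
| ExecSkip s :
    exec Skip s s 1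
| ExecISet a idx e s :
    exec (ISet a idx e) s
      (State (update (imem s) a (ieval s idx) (ieval s e)) (rmem s))
      (itime idx + itime e).+1
| ExecRSet a idx e s :
    exec (RSet a idx e) s
      (State (imem s) (update (rmem s) a (ieval s idx) (reval s e)))
      (itime idx + rtime e).+1
| ExecSeq p q s s1 s2 t1 t2 :
    exec p s s1 t1 -> exec q s1 s2 t2 ->
    exec (Seq p q) s s2 (t1 + t2).+1
| ExecIfTrue b p q s s' t :
    teval s b -> exec p s s' t ->
    exec (If b p q) s s' (ttime b + t).+1
| ExecIfFalse b p q s s' t :
    ~~ teval s b -> exec q s s' t ->
    exec (If b p q) s s' (ttime b + t).+1
| ExecWhileFalse b p s :
    ~~ teval s b ->
    exec (While b p) s s (ttime b).+1
| ExecWhileTrue b p s s1 s2 t1 t2 :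
    teval s b -> exec p s s1 t1 -> exec (While b p) s1 s2 t2 ->
    exec (While b p) s s2 (ttime b + t1 + t2).+1.

Lemma exec_det p s s1 s2 t1 t2 :
  exec p s s1 t1 -> exec p s s2 t2 -> s1 = s2 /\ t1 = t2.
Proof.
move=> H1; elim: H1 s2 t2 => {p s s1 t1}.
- by move=> s s2 t2 H2; inversion H2.
- by move=> a idx e s s2 t2 H2; inversion H2.
- by move=> a idx e s s2 t2 H2; inversion H2.
- move=> p q s s1 s2 t1 t2 _ IHp _ IHq s2' t2' H2; inversion H2; subst.
  match goal with
    H : exec p s _ _, K : exec q _ s2' _ |- _ =>
      case: (IHp _ _ H) => ? ?; subst; case: (IHq _ _ K) => ? ?; by subst
  end.
- move=> b p q s s' t b_s _ IH s2 t2 H2; inversion H2; subst.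
    by match goal with H : exec p s _ _ |- _ =>
      case: (IH _ _ H) => ? ?; subst end.
  by match goal with H : is_true (~~ _) |- _ => rewrite b_s in H end.
- move=> b p q s s' t b_s _ IH s2 t2 H2; inversion H2; subst.
    by match goal with H : is_true (teval _ _) |- _ => rewrite H in b_s end.
  by match goal with H : exec q s _ _ |- _ =>
    case: (IH _ _ H) => ? ?; subst end.
- move=> b p s b_s s2 t2 H2; inversion H2; subst=> //.
  by match goal with H : is_true (teval _ _) |- _ => rewrite H in b_s end.
- move=> b p s s1 s2 t1 t2 b_s _ IHp _ IHq s2' t2' H2; inversion H2; subst.
    by match goal with H : is_true (~~ _) |- _ => rewrite b_s in H end.
  match goal with
    H : exec p s _ _, K : exec (While b p) _ s2' _ |- _ =>
      case: (IHp _ _ H) => ? ?; subst; case: (IHq _ _ K) => ? ?; by subst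
  end.
Qed.

Section Encoding.
Context {n l : nat}.
Implicit Type I : instance R n l.

(* The index of the part containing item i (0 by default). *)
Definition part_of I (i : 'I_n) : nat :=
  if [pick j | i \in part I j] is Some j then val j else 0%N.

Definition ord_array (V : Type) (v0 : V) (f : 'I_n -> V) (k : nat) : V :=
  if insub k is Some i then f i else v0.

(* Input: integer arrays 0, 1 and 2 hold n, l and Gamma in their cell 0, and
   cell i of integer array 3 holds the index of the part containing item i;
   real arrays 0 to 3 hold the four cost vectors.  All other cells contain 0. *)
Definition encode I : state R := State
  (fun a k => match a, k with
    | 0, 0 => n
    | 1, 0 => l
    | 2, 0 => Gamma I
    | 3, _ => ord_array 0%N (part_of I) k
    | _, _ => 0
    end)%N
  (fun a k => match a with
    | 0%N => ord_array 0 (c_lo I 0) k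
    | 1%N => ord_array 0 (c_up I 0) k
    | 2%N => ord_array 0 (d_lo I 0) k
    | 3%N => ord_array 0 (d_up I 0) k
    | _ => 0
    end).

End Encoding.

Definition output s : R := rmem s 4 0.

End Semantics.

Definition bigO_nat (f g : nat -> nat) : Prop :=
  exists C N : nat, forall n : nat, (N <= n)%N -> (f n <= C * g n)%N.

(* A single program, not depending on the dimensions, computes Rob for every
   instance of the class [Q], within T n steps on instances with n items. *)
Definition solves_in_time
    (Q : forall (R : realType) (n l : nat), instance R n l -> Prop)
    (p : cmd) (T : nat -> nat) : Prop :=
  forall (R : realType) (n l : nat) (I : instance R n l), Q R n l I ->
    exists (s : state R) (t : nat),
      [/\ exec p (encode I) s t, (t <= T n)%N & Rob I = (output s)%:E].

Definition solvable_in_bigO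
    (Q : forall (R : realType) (n l : nat), instance R n l -> Prop)
    (g : nat -> nat) : Prop :=
  exists (p : cmd) (T : nat -> nat), bigO_nat T g /\ solves_in_time Q p T.

(* Main.v *)
Require Import Defs.
From mathcomp Require Import all_boot all_order all_algebra.
From mathcomp Require Import boolp classical_sets reals constructive_ereal ereal.
From mathcomp Require Import zify ring lra.

(** Write lo for the lower costs, dev = up - lo for the deviations, and let
    D(u) be the largest deviation of an item chosen by u, or 0 if there is none.
    With a budget of one attack the adversary has two sensible plans once x is
    bought.  Striking x at once costs D(x) but leaves certainty afterwards, so
    that every open pair is closed by its cheaper item, at total cost m(x).
    Waiting lets the adversary strike the completion y instead.  As y may be
    chosen knowing that no strike occurred,
    Rob is the minimum over x and y of
      max (lo(x) + m(x) + D(x), lo(x) + lo(y) + D(y)).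

    Guess thresholds t1 for D(x) and t2 for D(y).  Given the thresholds, the two
    sums under the max split over the pairs, and in each pair {a, b} with
    lo a <= lo b a single choice is best for both sums at once:
      - a within t1 or t2: take a, contributing (lo a, lo a);
      - otherwise b within t2: leave the pair open and complete it with b if the
        adversary waits and with a if not, contributing (lo a, lo b);
      - otherwise b within t1: buy b, contributing (lo b, lo b);
      - otherwise no choice respects the guess: buy b and charge up b instead of
        lo b to the first sum, which pays for the violated threshold.
    There being no trade-off inside a pair, a guess is evaluated in linear time.
    Every guess is the cost bound of an actual strategy ([Rob_le_guess]), and the
    guess (D(x), D(y)) of an optimal pair is no worse than its cost ([guess_le],
    [le_Rob]).  Since D takes only the values dev i and 0, trying the
    (n + 1) ^ 2 guesses takes cubic time; a quadratic precomputation of the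
    partner of each item makes each pair accessible in constant time.  The
    program doing this is [solve], and [solve_ok] bounds its running time. *)

Set Implicit Arguments.
Unset Strict Implicit.
Unset Printing Implicit Defensive.

Import Order.TTheory GRing.Theory Num.Theory.
Local Open Scope ring_scope.

(** * The value of a guess *)

Section Guess.
Context {R : realType}.
Variables (n : nat) (lo up : nat -> R) (mate : nat -> nat).

Definition deviation k := up k - lo k.

(** Ties are broken by index, so that exactly one item of each pair is the
    cheaper one and a sum over these items is a sum over the pairs. *)
Definition cheaper a : bool :=
  (lo a <= lo (mate a)) && ~~ ((lo (mate a) <= lo a) && (mate a <= a)%N).

(** The contribution of the pair of the cheaper item [a] to the cost when the
    adversary strikes the first stage; the last case carries the penalty for a
    pair in which no choice respects the guess. *)
Definition struck_share t1 t2 a : R :=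
  if (deviation a <= t1) || (deviation a <= t2) then lo a
  else if deviation (mate a) <= t2 then lo a
  else if deviation (mate a) <= t1 then lo (mate a) else up (mate a).

(** The contribution of the same pair when the adversary waits. *)
Definition waiting_share t1 t2 a : R :=
  if (deviation a <= t1) || (deviation a <= t2) then lo a else lo (mate a).

Definition guess_value t1 t2 : R :=
  Num.max (t1 + \sum_(0 <= a < n | cheaper a) struck_share t1 t2 a)
          (t2 + \sum_(0 <= a < n | cheaper a) waiting_share t1 t2 a).

End Guess.

(** * Parts with two items as an involution *)

Section Pairing.
Context {R : realType} {n l : nat}.
Variable I : instance R n l.
Hypotheses (I_wf : well_formed I) (I_pairs : forall j, #|part I j| = 2%N).

Definition matched (i k : 'I_n) : bool :=
  (k != i) && (part_of I k == part_of I i).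

Definition mate_of (i : 'I_n) : 'I_n := odflt i [pick k | matched i k].

Lemma in_some_part i : exists j, i \in part I j.
Proof.
case: I_wf => /and3P[/eqP cov _ _] _ _ _.
have : i \in finset.cover (part I @: [set: 'I_l]%SET)%SET by rewrite cov inE.
by rewrite cover_imset => /bigcupP[j _ ij]; exists j.
Qed.

Lemma part_uniq i j j' : i \in part I j -> i \in part I j' -> j = j'.
Proof.
case: I_wf => /and3P[_ /finset.trivIsetP triv _] inj _ _ ij ij'.
apply/eqP/negPn/negP => jj'.
have := triv (part I j) (part I j').
rewrite !imset_f ?inE // => /(_ isT isT).
rewrite (inj_eq inj) => /(_ jj') /pred0P /(_ i) /=.
by rewrite ij ij'.
Qed.

Lemma part_ofE i j : i \in part I j -> part_of I i = j.
Proof.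
rewrite /part_of => ij; case: pickP => [j' ij'|/(_ j)]; last by rewrite ij.
by rewrite (part_uniq ij ij').
Qed.

Lemma part_pair i j : i \in part I j ->
  part I j = [set i; mate_of i]%SET /\ mate_of i != i.
Proof.
move=> ij; have := I_pairs j => /eqP/cards2P[a [b [ab pE]]].
have mE k : matched i k = (k != i) && (k \in part I j).
  rewrite /matched (part_ofE ij); have [j' kj'] := in_some_part k.
  rewrite (part_ofE kj'); congr andb; apply/eqP/idP => [/val_inj <- //|kj].
  by rewrite (part_uniq kj kj').
rewrite /mate_of; case: pickP => [k|none].
  rewrite mE => /andP[ki kj] /=; split=> //; apply/setP => x.
  move: ij kj ki; rewrite pE !inE.
  move=> /orP[] /eqP-> /orP[] /eqP->; rewrite ?eqxx // => _.
  exact: orbC.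
move: ij; rewrite pE !inE => /orP[] /eqP iE.
- by have := none b; rewrite mE pE !inE eqxx orbT iE eq_sym ab.
- by have := none a; rewrite mE pE !inE eqxx iE ab.
Qed.

Lemma mate_neq i : mate_of i != i.
Proof. by have [j /part_pair[]] := in_some_part i. Qed.

Lemma mateK : involutive mate_of.
Proof.
move=> i; have [j ij] := in_some_part i; have [pE mi] := part_pair ij.
have mj : mate_of i \in part I j by rewrite pE !inE eqxx orbT.
have [pE' mm] := part_pair mj.
have : i \in part I j by [].
by rewrite pE' !inE eq_sym (negbTE mi) => /eqP.
Qed.

Lemma matchedE i k : matched i k = (k == mate_of i).
Proof.
have [j ij] := in_some_part i; have [pE mi] := part_pair ij.
rewrite /matched (part_ofE ij); have [j' kj'] := in_some_part k.
rewrite (part_ofE kj'); apply/andP/eqP => [[ki /eqP/val_inj jj']|kE].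
  by move: kj'; rewrite jj' pE !inE (negbTE ki) => /eqP.
split; first by rewrite kE.
apply/eqP; congr val; apply: (part_uniq kj').
by rewrite kE pE !inE eqxx orbT.
Qed.

Lemma binary_ge0 (x : 'rV[R]_n) i : binary x -> 0 <= x 0 i.
Proof. by move=> /(_ i)[]->. Qed.

(** On binary vectors, the pair equations already force x + y to be binary. *)
Lemma X_secondP x y : binary x ->
  X_second I x y <->
  binary y /\ forall i, x 0 i + y 0 i + (x 0 (mate_of i) + y 0 (mate_of i)) = 1.
Proof.
move=> x01; split=> [[y01 _ [_ nom]]|[y01 pair]].
  split=> // i; have [j ij] := in_some_part i; have [pE mi] := part_pair ij.
  by have := nom j; rewrite pE big_setU1 ?inE 1?eq_sym // big_set1 !mxE.
have xy01 i : (x + y) 0 i = 0 \/ (x + y) 0 i = 1.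
  have := pair i; rewrite !mxE.
  have := binary_ge0 (mate_of i) x01; have := binary_ge0 (mate_of i) y01.
  case: (x01 i) => ->; case: (y01 i) => -> ? ? ?.
  - by left; rewrite addr0.
  - by right; rewrite add0r.
  - by right; rewrite addr0.
  - by exfalso; lra.
have xy1 i : (x + y) 0 i <= 1 by case: (xy01 i) => -> //; exact: ler01.
split=> //.
split=> // j; have := I_pairs j => /eqP/cards2P[i [k [_ pE0]]].
have ij : i \in part I j by rewrite pE0 !inE eqxx.
have [pE mi] := part_pair ij.
rewrite pE big_setU1 ?inE 1?eq_sym // big_set1 !mxE.
exact: pair.
Qed.

End Pairing.

(** * The robust value as a minimum over guesses *)

Section Rob.
Local Open Scope classical_set_scope.
Context {R : realType} {n l : nat}.
Variable I : instance R n l.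
Hypotheses (I_wf : well_formed I) (I_pairs : forall j, #|part I j| = 2%N).
Hypotheses (I_budget : Gamma I = 1%N).
Hypotheses (same_lo : c_lo I = d_lo I) (same_up : c_up I = d_up I).

Implicit Types (c d x y delta : 'rV[R]_n).

Local Notation lo := (ord_array 0 (c_lo I 0)).
Local Notation up := (ord_array 0 (c_up I 0)).
Local Notation mate := (ord_array 0%N (fun i => mate_of I i : nat)).
Local Notation dev := (deviation lo up).
Local Notation cheap := (cheaper lo mate).
Local Notation guess := (guess_value n lo up mate).

Lemma ord_arrayE (V : Type) (v0 : V) (f : 'I_n -> V) (i : 'I_n) :
  ord_array v0 f i = f i.
Proof. by rewrite /ord_array valK. Qed.

(** Reading cell [n] yields the threshold 0, attained by D when nothing is
    chosen; the indices 0, ..., n thus enumerate all thresholds. *)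
Lemma dev_outside : dev n = 0.
Proof.
by rewrite /deviation /ord_array insubF ?ltnn // subr0.
Qed.

Lemma devE (i : 'I_n) : dev i = c_up I 0 i - c_lo I 0 i.
Proof. by rewrite /deviation !ord_arrayE. Qed.

Lemma lo_ge0 (i : 'I_n) : 0 <= lo i.
Proof. by case: I_wf => _ _ /(_ i)/andP[? _] _; rewrite ord_arrayE. Qed.

Lemma dev_ge0 (i : 'I_n) : 0 <= dev i.
Proof. by case: I_wf => _ _ /(_ i)/andP[_ ?] _; rewrite devE subr_ge0. Qed.

Lemma dev_nat_ge0 (k : nat) : 0 <= dev k.
Proof.
have [kn|nk] := ltnP k n; first exact: (dev_ge0 (Ordinal kn)).
by rewrite /deviation /ord_array insubF ?subrr // ltnNge nk.
Qed.

Lemma mateE (i : 'I_n) : mate i = mate_of I i.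
Proof. exact: ord_arrayE. Qed.

Lemma cheap_mate (i : 'I_n) : cheap (mate_of I i) = ~~ cheap i.
Proof.
rewrite /cheaper !ord_arrayE mateK //.
have := mate_neq I_wf I_pairs i; rewrite -val_eqE /=.
case: (ltngtP (mate_of I i) i) => // _ _;
  by case: (ltgtP (c_lo I 0 i) (c_lo I 0 (mate_of I i))).
Qed.

Lemma sum_pairs (f : 'I_n -> R) :
  \sum_i f i = \sum_(i < n | cheap i) (f i + f (mate_of I i)).
Proof.
rewrite (bigID (fun i : 'I_n => cheap i)) big_split; congr (_ + _).
rewrite (reindex_inj (inv_inj (mateK I_wf I_pairs))).
by apply: eq_bigl => i; rewrite cheap_mate negbK.
Qed.

(** The damage of a single attack on [u]; [q] measures by how much an item may
    exceed the threshold [T], and a unit budget pays at most for the total. *)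
Lemma attack_le (delta u : 'rV[R]_n) (q : 'I_n -> R) (T : R) :
    binary delta -> \sum_i delta 0 i <= 1 -> 0 <= T -> (forall i, 0 <= q i) ->
    (forall i : 'I_n, dev i * u 0 i <= T + q i) ->
  \sum_(i < n) dev i * delta 0 i * u 0 i <= T + \sum_i q i.
Proof.
move=> delta01 budget T0 q0 bound.
have : \sum_(i < n) dev i * delta 0 i * u 0 i <=
       \sum_(i < n) (T * delta 0 i + q i).
  apply: ler_sum => i _; have := bound i; have := q0 i.
  by case: (delta01 i) => ->; rewrite ?mulr0 ?mul0r ?mulr1 ?add0r.
move=> /le_trans; apply; rewrite big_split lerD2r -mulr_sumr.
by rewrite ler_piMr.
Qed.

(** The damage D(u) is reached, and it is one of the guessed thresholds. *)
Lemma worst_attack (u : 'rV[R]_n) : binary u ->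
  exists (k : nat) (delta : 'rV[R]_n),
    [/\ (k <= n)%N, binary delta, \sum_i delta 0 i <= 1,
        \sum_(i < n) dev i * delta 0 i * u 0 i = dev k
      & forall i : 'I_n, u 0 i = 1 -> dev i <= dev k].
Proof.
move=> u01; case: (pickP (fun i => u 0 i == 1)) => [i0 u0|none].
  have := @arg_maxP _ R _ i0 (fun i => u 0 i == 1) (fun i : 'I_n => dev i) u0.
  case=> k uk kmax.
  have sum1 (f : 'I_n -> R) : \sum_i f i * (delta_mx 0 k : 'rV[R]_n) 0 i = f k.
    rewrite (bigD1 k) //= mxE !eqxx mulr1 big1 ?addr0 // => i ik.
    by rewrite mxE eqxx (negbTE ik) mulr0.
  exists k, (delta_mx 0 k); split.
  - exact: ltnW.
  - by move=> i; rewrite mxE; case: (_ && _); [right|left].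
  - by have := sum1 (fun=> 1); under eq_bigr do rewrite mul1r; move=> ->.
  - under eq_bigr do rewrite mulrAC.
    by rewrite (sum1 (fun i => dev i * u 0 i)) (eqP uk) mulr1.
  - by move=> i /eqP ui; exact: kmax.
exists n, 0; split=> //.
- by move=> i; left; rewrite mxE.
- by rewrite big1 // => i _; rewrite mxE.
- by rewrite dev_outside big1 // => i _; rewrite mxE mulr0 mul0r.
- by move=> i /eqP; rewrite none.
Qed.

Lemma U_firstP c : U_first I c <->
  exists delta, [/\ binary delta,
    forall i : 'I_n, c 0 i = lo i + dev i * delta 0 i & \sum_i delta 0 i <= 1].
Proof.
split=> [[_ [delta [d01 cE budget]]]|[delta [d01 cE budget]]].
  exists delta; split=> //; last by move: budget; rewrite I_budget.
  by move=> i; rewrite cE devE ord_arrayE.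
split.
  move=> i; rewrite cE addr_ge0 ?lo_ge0 // mulr_ge0 ?dev_ge0 //.
  exact: binary_ge0.
exists delta; split=> //; last by rewrite I_budget.
by move=> i; rewrite cE devE ord_arrayE.
Qed.

(** An attack on an item of deviation 0 is invisible in [c], hence leaves the
    budget of the second stage untouched. *)
Definition spent (delta : 'rV[R]_n) : R := \sum_(i < n | dev i != 0) delta 0 i.

Lemma U_secondP c delta : (forall i : 'I_n, c 0 i = lo i + dev i * delta 0 i) ->
  forall d, U_second I c d <->
  exists delta', [/\ binary delta',
    forall i : 'I_n, d 0 i = lo i + dev i * delta' 0 i
    & \sum_i delta' 0 i <= 1 - spent delta].
Proof.
move=> cE d.
have spentE : \sum_i (c 0 i - c_lo I 0 i) / (c_up I 0 i - c_lo I 0 i)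
    = spent delta.
  rewrite /spent [RHS]big_mkcond; apply: eq_bigr => i _.
  rewrite cE -devE ord_arrayE addrC addKr.
  case: ifPn => [ne0|]; first by rewrite mulrAC divff ?mul1r.
  by rewrite negbK => /eqP->; rewrite invr0 mulr0.
split=> [[_ [delta' [d01 dE]]]|[delta' [d01 dE budget]]].
  rewrite I_budget spentE => budget.
  exists delta'; split=> //.
  by move=> i; rewrite dE devE ord_arrayE same_lo same_up.
split.
  move=> i; rewrite dE addr_ge0 ?lo_ge0 // mulr_ge0 ?dev_ge0 //.
  exact: binary_ge0.
exists delta'; rewrite I_budget spentE; split=> //.
by move=> i; rewrite dE devE ord_arrayE same_lo same_up.
Qed.

Lemma spent_le delta :
  binary delta -> \sum_i delta 0 i <= 1 -> spent delta <= 1.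
Proof.
move=> d01; apply: le_trans; rewrite /spent big_mkcond; apply: ler_sum => i _.
by case: ifP => // _; exact: binary_ge0.
Qed.

Lemma costE c d (x y delta delta' : 'rV[R]_n) :
    (forall i : 'I_n, c 0 i = lo i + dev i * delta 0 i) ->
    (forall i : 'I_n, d 0 i = lo i + dev i * delta' 0 i) ->
  cost c d x y =
    \sum_(i < n) (lo i * x 0 i + lo i * y 0 i)
    + (\sum_(i < n) dev i * delta 0 i * x 0 i
       + \sum_(i < n) dev i * delta' 0 i * y 0 i).
Proof.
move=> cE dE; rewrite /cost -!big_split /=; apply: eq_bigr => i _.
by rewrite cE dE; ring.
Qed.

Lemma spent_ge1 delta : binary delta -> spent delta != 0 -> 1 <= spent delta.
Proof.
move=> d01.
have [all0|] := boolP [forall i : 'I_n, (dev i != 0) ==> (delta 0 i == 0)].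
  rewrite /spent big1 ?eqxx // => i di.
  by have /forallP/(_ i) := all0; rewrite di => /eqP.
rewrite negb_forall => /existsP[i].
rewrite negb_imply => /andP[di /eqP deltai] _.
rewrite /spent (bigD1 i) //=; case: (d01 i) => [//|->].
by rewrite lerDl sumr_ge0 // => k _; exact: binary_ge0.
Qed.

Lemma no_budget_no_attack delta :
  binary delta -> \sum_i delta 0 i <= 0 -> delta = 0.
Proof.
move=> d01 le0; apply/rowP => i; rewrite mxE.
have ge0 k : 0 <= delta 0 k by exact: binary_ge0.
apply/eqP; rewrite eq_le ge0 andbT; apply: le_trans le0.
by rewrite (bigD1 i) //= lerDl sumr_ge0.
Qed.

(** The greedy choice in each pair is a strategy against which no adversary gets
    more than the value of the guess: if the first attack is visible then no
    budget is left, so the cheapest completion is safe; otherwise the completion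
    within the threshold [t2] is used. *)
Lemma Rob_le_guess (t1 t2 : R) : 0 <= t1 -> 0 <= t2 ->
  (Rob I <= (guess t1 t2)%:E)%E.
Proof.
move=> t1_ge0 t2_ge0.
pose le1 (i : 'I_n) := dev i <= t1; pose le2 (i : 'I_n) := dev i <= t2.
pose m := mate_of I.
(* On the dearer item of a pair: the cheaper one exceeds both thresholds. *)
pose forced i := ~~ le1 (m i) && ~~ le2 (m i).
(* The first stage, the completion if the adversary waits, the completion after
   a visible strike, and the violation of [t1] by the first stage. *)
pose buy (i : 'I_n) := if cheap i then le1 i else forced i && ~~ le2 i.
pose reply (i : 'I_n) :=
  if cheap i then ~~ le1 i && le2 i else forced i && le2 i.
pose relief (i : 'I_n) := cheap i && ~~ le1 i && (le2 i || le2 (m i)).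
pose excess (i : 'I_n) :=
  if ~~ cheap i && forced i && ~~ le2 i && ~~ le1 i then dev i else 0.
pose v (b : 'I_n -> bool) : 'rV[R]_n := \row_i (b i)%:R.
have v01 b : binary (v b) by move=> i; rewrite mxE; case: (b i); [right|left].
have pairs (b : 'I_n -> bool) : (forall i : 'I_n, cheap i ->
      buy i + b i + (buy (m i) + b (m i)) = 1)%N -> X_second I (v buy) (v b).
  move=> E; apply/X_secondP => //; split=> // i.
  have [ci|ci] := boolP (cheap i); rewrite !mxE -!natrD -/m; first by rewrite E.
  have := E (m i); rewrite cheap_mate ci /m mateK // => /(_ isT).
  by rewrite addnC => ->.
have X_y : X_second I (v buy) (v reply).
  apply: pairs => i ci; rewrite /buy /reply /forced ci cheap_mate ci /= /m mateK //.
  by case: (le1 i); case: (le2 i); case: (le2 (mate_of I i)).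
have X_z : X_second I (v buy) (v relief).
  apply: pairs => i ci; rewrite /buy /relief /forced ci cheap_mate ci /= /m mateK //.
  by case: (le1 i); case: (le2 i); case: (le2 (mate_of I i)).
have excess_ge0 i : 0 <= excess i.
  by rewrite /excess; case: ifP => // _; exact: dev_ge0.
have x_dev (i : 'I_n) : dev i * (v buy) 0 i <= t1 + excess i.
  rewrite mxE /buy /excess /le1 /le2.
  case: (cheap i) (forced i) => [] [] /=; case: (lerP (dev i) t1) => ? /=;
    by case: (lerP (dev i) t2) => ? /=; rewrite ?mulr1 ?mulr0; lra.
have y_dev (i : 'I_n) : dev i * (v reply) 0 i <= t2 + 0.
  rewrite mxE /reply addr0 /le2.
  case: (cheap i) (forced i) => [] [] /=; case: (le1 i) => /=;
    by case: (lerP (dev i) t2) => ? /=; rewrite ?mulr1 ?mulr0; lra.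
have sum1 : \sum_(0 <= a < n | cheap a) struck_share lo up mate t1 t2 a
   = \sum_(i < n) (lo i * (v buy) 0 i + lo i * (v relief) 0 i) + \sum_i excess i.
  rewrite -big_split sum_pairs big_mkord; apply: eq_bigr => i ci.
  rewrite !mxE /buy /relief /excess /forced /struck_share.
  rewrite ci cheap_mate ci /= /m mateK // mateE.
  rewrite -/(le1 i) -/(le2 i) -/(le1 (mate_of I i)) -/(le2 (mate_of I i)).
  have -> : up (mate_of I i) = lo (mate_of I i) + dev (mate_of I i).
    by rewrite /deviation; ring.
  by case: (le1 i); case: (le2 i); case: (le2 (mate_of I i)); case: (le1 (mate_of I i)) => /=; ring.
have sum2 : \sum_(0 <= a < n | cheap a) waiting_share lo up mate t1 t2 a
   = \sum_(i < n) (lo i * (v buy) 0 i + lo i * (v reply) 0 i).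
  rewrite sum_pairs big_mkord; apply: eq_bigr => i ci.
  rewrite !mxE /buy /reply /forced /waiting_share.
  rewrite ci cheap_mate ci /= /m mateK // mateE.
  rewrite -/(le1 i) -/(le2 i) -/(le1 (mate_of I i)) -/(le2 (mate_of I i)).
  by case: (le1 i); case: (le2 i); case: (le2 (mate_of I i)); case: (le1 (mate_of I i)) => /=; ring.
apply: ge_ereal_inf; exists (ereal_sup [set ereal_inf [set ereal_sup
    [set (cost c d (v buy) y)%:E | d in U_second I c]
       | y in X_second I (v buy)] | c in U_first I]); first by exists (v buy).
apply: ge_ereal_sup => _ [c /U_firstP [delta [d01 cE budget]] <-].
have [spent0|spent1] := eqVneq (spent delta) 0.
  (* No visible strike: the budget remains for an attack on the completion. *)
  apply: ge_ereal_inf; exists (ereal_sup [set (cost c d (v buy) (v reply))%:E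
    | d in U_second I c]); first by exists (v reply).
  apply: ge_ereal_sup => _ [d /(U_secondP cE) [delta' [d01' dE budget']] <-].
  rewrite lee_fin /guess_value le_max; apply/orP; right.
  rewrite (costE _ _ cE dE) sum2 addrC lerD2r.
  have -> : \sum_(i < n) dev i * delta 0 i * (v buy) 0 i = 0.
    apply: big1 => i _; have [->|di] := eqVneq (dev i) 0; first by rewrite !mul0r.
    have : spent delta <= 0 by rewrite spent0.
    rewrite /spent (bigD1 i) //= => le0.
    have : delta 0 i <= 0.
      by apply: le_trans le0; rewrite lerDl sumr_ge0 // => k _; exact: binary_ge0.
    by case: (d01 i) => -> //; rewrite ?mulr0 ?mul0r // ler10.
  rewrite add0r; rewrite spent0 subr0 in budget'.
  have := attack_le (q := fun=> 0) d01' budget' t2_ge0 (fun=> lexx 0) y_dev.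
  by rewrite sumr_const mul0rn addr0.
(* A visible strike exhausts the budget, so the second stage is certain. *)
apply: ge_ereal_inf; exists (ereal_sup [set (cost c d (v buy) (v relief))%:E
  | d in U_second I c]); first by exists (v relief).
apply: ge_ereal_sup => _ [d /(U_secondP cE) [delta' [d01' dE budget']] <-].
rewrite lee_fin /guess_value le_max; apply/orP; left.
have delta'0 : delta' = 0.
  by apply: no_budget_no_attack => //; have := spent_ge1 d01 spent1; lra.
rewrite (costE _ _ cE dE) sum1 delta'0.
rewrite [X in _ + (_ + X)]big1 => [|i _]; last by rewrite mxE mulr0 mul0r.
have := attack_le d01 budget t1_ge0 excess_ge0 x_dev; lra.
Qed.

(** Greed is best in every pair.  If the cheaper item exceeds both thresholds,
    then [x] and [y] must use the dearer one, and it has to be bought in [x]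
    unless it is within [t2]; in the other cases [lo a] is a trivial bound. *)
Lemma guess_le x y z (t1 t2 : R) :
    binary x -> X_second I x y -> X_second I x z ->
    (forall i : 'I_n, x 0 i = 1 -> dev i <= t1) ->
    (forall i : 'I_n, y 0 i = 1 -> dev i <= t2) ->
  guess t1 t2 <= Num.max
    (t1 + \sum_(i < n) (lo i * x 0 i + lo i * z 0 i))
    (t2 + \sum_(i < n) (lo i * x 0 i + lo i * y 0 i)).
Proof.
move=> x01 /(X_secondP I_wf I_pairs _ x01) [y01 xy].
move=> /(X_secondP I_wf I_pairs _ x01) [z01 xz] xt1 yt2.
rewrite /guess_value ge_max !le_max !lerD2l; apply/andP.
suff shares (i : 'I_n) : cheap i ->
    struck_share lo up mate t1 t2 i <= lo i * x 0 i + lo i * z 0 i +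
      (lo (mate_of I i) * x 0 (mate_of I i) + lo (mate_of I i) * z 0 (mate_of I i)) /\
    waiting_share lo up mate t1 t2 i <= lo i * x 0 i + lo i * y 0 i +
      (lo (mate_of I i) * x 0 (mate_of I i) + lo (mate_of I i) * y 0 (mate_of I i)).
  by split; apply/orP; [left|right]; rewrite sum_pairs big_mkord;
    apply: ler_sum => i /shares[].
rewrite {1}/cheaper mateE => /andP[lo_i _].
rewrite /struck_share /waiting_share mateE.
set a := lo i in lo_i *; set b := lo (mate_of I i) in lo_i *.
have a_ge0 : 0 <= a by exact: lo_ge0.
have b_ge0 : 0 <= b by exact: lo_ge0.
have one_each (w : 'rV[R]_n) : binary w ->
    x 0 i + w 0 i + (x 0 (mate_of I i) + w 0 (mate_of I i)) = 1 ->
    a <= a * x 0 i + a * w 0 i + (b * x 0 (mate_of I i) + b * w 0 (mate_of I i)).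
  move=> w01 E; rewrite -{1}[a]mulr1 -E !mulrDr lerD2l.
  by rewrite lerD // ler_wpM2r //; exact: binary_ge0.
have [_|] := boolP ((dev i <= t1) || (dev i <= t2)).
  by split; exact: one_each.
rewrite negb_or => /andP[over1 over2].
have xi0 : x 0 i = 0 by case: (x01 i) => // /xt1; rewrite (negbTE over1).
have yi0 : y 0 i = 0 by case: (y01 i) => // /yt2; rewrite (negbTE over2).
have := xy i; rewrite xi0 yi0 !mulr0 !add0r => xym.
split; last by rewrite -mulrDr xym mulr1.
case: ifPn => [_|over2m].
  by have := one_each z z01 (xz i); rewrite xi0 mulr0 add0r.
have ym0 : y 0 (mate_of I i) = 0.
  by case: (y01 (mate_of I i)) => // /yt2; rewrite (negbTE over2m).
rewrite ym0 addr0 in xym; rewrite xt1 // xym mulr1.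
have := mulr_ge0 a_ge0 (binary_ge0 i z01).
by have := mulr_ge0 b_ge0 (binary_ge0 (mate_of I i) z01); lra.
Qed.

(** If some first stage [x] kept the adversary below [v], then [x] would have a
    completion [z] beating [v] after the worst strike on [x] itself, and a
    completion [y] beating [v] when the adversary waits and then makes the worst
    strike on [y]; by [guess_le] the guess (D(x), D(y)) would be below [v].  The
    two scenarios are tested separately, so no minimax argument is needed. *)
Lemma le_Rob (v : R) :
    (forall j k, (j <= n)%N -> (k <= n)%N -> v <= guess (dev j) (dev k)) ->
  (v%:E <= Rob I)%E.
Proof.
move=> v_le; apply: le_ereal_inf_tmp => _ [x x01 <-].
rewrite leNgt; apply/negP => sup_lt.
have beaten delta : binary delta -> \sum_i delta 0 i <= 1 -> exists y,
    [/\ binary y, X_second I x y &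
      forall delta', binary delta' -> \sum_i delta' 0 i <= 1 - spent delta ->
      \sum_(i < n) (lo i * x 0 i + lo i * y 0 i)
      + (\sum_(i < n) dev i * delta 0 i * x 0 i
         + \sum_(i < n) dev i * delta' 0 i * y 0 i) < v].
  move=> d01 budget.
  pose c : 'rV[R]_n := \row_i (lo i + dev i * delta 0 i).
  have cE (i : 'I_n) : c 0 i = lo i + dev i * delta 0 i by rewrite mxE.
  have Uc : U_first I c by apply/U_firstP; exists delta.
  have : (ereal_inf [set ereal_sup [set (cost c d x y)%:E | d in U_second I c]
       | y in X_second I x] < v%:E)%E.
    by apply: le_lt_trans sup_lt; apply: ereal_sup_ubound; exists c.
  move=> /ereal_inf_lt[_ [y Xy <-] sup_d]; exists y; split=> //; first by case: Xy.
  move=> delta' d01' budget'.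
  pose d : 'rV[R]_n := \row_i (lo i + dev i * delta' 0 i).
  have dE (i : 'I_n) : d 0 i = lo i + dev i * delta' 0 i by rewrite mxE.
  rewrite -(costE _ _ cE dE) -lte_fin; apply: le_lt_trans sup_d.
  by apply: ereal_sup_ubound; exists d => //; apply/(U_secondP cE); exists delta'.
have zero01 : binary (0 : 'rV[R]_n) by move=> i; left; rewrite mxE.
have sum0 : \sum_i (0 : 'rV[R]_n) 0 i = 0 by rewrite big1 // => i _; rewrite mxE.
have spent0 : spent 0 = 0 by rewrite /spent big1 // => i _; rewrite mxE.
have dev0 (u : 'rV[R]_n) : \sum_(i < n) dev i * (0 : 'rV[R]_n) 0 i * u 0 i = 0.
  by rewrite big1 // => i _; rewrite mxE mulr0 mul0r.
(* The worst strike on [x], and no attack afterwards. *)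
have [j [delta [jn d01 budget dx xj]]] := worst_attack x01.
have [z [z01 Xz]] := beaten delta d01 budget.
move=> /(_ 0 zero01); rewrite sum0 subr_ge0 => /(_ (spent_le d01 budget)).
rewrite dx dev0 => lt1.
(* The adversary waits, then makes the worst strike on the reply. *)
have [|y [y01 Xy]] := beaten 0 zero01; first by rewrite sum0.
have [k [delta' [kn d01' budget' dy yk]]] := worst_attack y01.
move=> /(_ delta' d01'); rewrite spent0 subr0 => /(_ budget').
rewrite dy dev0 => lt2.
have := le_trans (v_le j k jn kn) (guess_le x01 Xy Xz xj yk).
by rewrite le_max => /orP[]; lra.
Qed.

End Rob.

(** * Running programs *)

(** A total correctness judgement with a time bound, composed below by the usual
    rules of Hoare logic. *)
Definition runs (R : realType) (p : cmd) (s : state R) (T : nat)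
    (Q : state R -> Prop) : Prop :=
  exists s' t, [/\ exec p s s' t, (t <= T)%N & Q s'].

Fixpoint loop_free (p : cmd) : bool :=
  match p with
  | Seq p q | If _ p q => loop_free p && loop_free q
  | While _ _ => false
  | _ => true
  end.

(** The final state of a loop-free program as a function of the initial one, so
    that such programs are verified by computation; the value on a loop is
    arbitrary. *)
Fixpoint denote (R : realType) (p : cmd) (s : state R) : state R :=
  match p with
  | ISet a idx e =>
      State (update (imem s) a (ieval s idx) (ieval s e)) (rmem s)
  | RSet a idx e =>
      State (imem s) (update (rmem s) a (ieval s idx) (reval s e))
  | Seq p q => denote q (denote p s)
  | If b p q => if teval s b then denote p s else denote q s
  | _ => s
  end.

Fixpoint max_time (p : cmd) : nat :=
  match p with
  | Skip => 1
  | ISet _ idx e => (itime idx + itime e).+1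
  | RSet _ idx e => (itime idx + rtime e).+1
  | Seq p q => (max_time p + max_time q).+1
  | If b p q => (ttime b + maxn (max_time p) (max_time q)).+1
  | While _ _ => 0
  end.

Section Runs.
Context {R : realType}.
Implicit Types (s : state R) (p q : cmd) (Q : state R -> Prop).

Lemma runs_loop_free p s Q :
  loop_free p -> Q (denote p s) -> runs p s (max_time p) Q.
Proof.
move=> pF Qs; suff [t [et tT]] : exists t,
    exec p s (denote p s) t /\ (t <= max_time p)%N by exists (denote p s), t.
elim: p s pF {Qs Q} => //=.
- by move=> s _; exists 1; split=> //; exact: ExecSkip.
- by move=> a idx e s _; eexists; split; [exact: ExecISet|].
- by move=> a idx e s _; eexists; split; [exact: ExecRSet|].
- move=> p IHp q IHq s /andP[/(IHp s) [t1 [e1 l1]]].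
  move=> /(IHq (denote p s)) [t2 [e2 l2]].
  by exists (t1 + t2).+1; split; [exact: ExecSeq e1 e2|lia].
- move=> b p IHp q IHq s /andP[/(IHp s) [t1 [e1 l1]] /(IHq s) [t2 [e2 l2]]].
  case: ifPn => bs.
    by exists (ttime b + t1).+1; split; [exact: ExecIfTrue|lia].
  by exists (ttime b + t2).+1; split; [exact: ExecIfFalse|lia].
Qed.

Lemma runs_seq p q s T1 T2 Q1 Q :
    runs p s T1 Q1 -> (forall s', Q1 s' -> runs q s' T2 Q) ->
  runs (Seq p q) s (T1 + T2).+1 Q.
Proof.
move=> [s1 [t1 [e1 l1 /[swap] qP]]] /qP [s2 [t2 [e2 l2 Qs]]].
by exists s2, (t1 + t2).+1; split=> //; [exact: ExecSeq e1 e2|lia].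
Qed.

Lemma runs_weaken p s T Q1 Q :
  runs p s T Q1 -> (forall s', Q1 s' -> Q s') -> runs p s T Q.
Proof. by move=> [s' [t [e l q]]] QQ; exists s', t; split=> //; exact: QQ. Qed.

Definition set_nat s v k := State (update (imem s) v 0 k) (rmem s).

End Runs.

Notation cell a := (IGet a (IConst 0)).
Notation rcell a := (RGet a (IConst 0)).

Definition For (v : nat) (bound : iexp) (p : cmd) : cmd :=
  Seq (ISet v (IConst 0) (IConst 0))
    (While (ILe (IAdd (cell v) (IConst 1)) bound)
       (Seq p (ISet v (IConst 0) (IAdd (cell v) (IConst 1))))).

(** Besides the body, an iteration evaluates the bound and spends 13 steps on the
    test and the increment; the additional iteration accounts for the
    initialisation of the counter and the final test. *)
Definition for_time (bound : iexp) (N T : nat) : nat :=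
  (N.+1 * (T + itime bound + 13))%N.

(** The invariant is stated apart from the counter: it must not be sensitive to
    it, and the body may only rely on its value and has to preserve it. *)
Lemma runs_for (R : realType) (v : nat) (bound : iexp) (p : cmd) (T N : nat)
    (Inv : nat -> state R -> Prop) (s : state R) :
    (forall s k, Inv k s -> ieval s bound = N) ->
    (forall s k j, Inv k s -> Inv k (set_nat s v j)) ->
    (forall s k, (k < N)%N -> Inv k s -> imem s v 0 = k ->
       runs p s T (fun s' => Inv k.+1 s' /\ imem s' v 0 = k)) ->
    Inv 0%N s ->
  runs (For v bound p) s (for_time bound N T) (Inv N).
Proof.
move=> boundP stab step Inv0.
suff loop m k s0 : (N - k = m)%N -> (k <= N)%N -> Inv k s0 -> imem s0 v 0 = k ->
    runs (While (ILe (IAdd (cell v) (IConst 1)) bound)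
       (Seq p (ISet v (IConst 0) (IAdd (cell v) (IConst 1))))) s0
      (m * (T + itime bound + 13) + itime bound + 6) (Inv N).
  have [s' [t [e l q]]] := loop N 0%N (set_nat s v 0) (subn0 N) (leq0n N)
    (stab _ _ _ Inv0) ltac:(by rewrite /= /update !eqxx).
  exists s', (3 + t).+1; split=> //; last by rewrite /for_time; lia.
  by apply: ExecSeq e; exact: (ExecISet v (IConst 0) (IConst 0) s).
elim: m k s0 => [|m IHm] k s0 mE kN Ik vk.
  have kE : k = N by lia.
  exists s0, (ttime (ILe (IAdd (cell v) (IConst 1)) bound)).+1.
  split; [|rewrite /=; lia|by rewrite -kE].
  by apply: ExecWhileFalse; rewrite /= (boundP _ _ Ik) vk kE addn1 ltnn.
have kN' : (k < N)%N by lia.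
have [s1 [t1 [e1 l1 [I1 v1]]]] := step _ _ kN' Ik vk.
have incr : exec (ISet v (IConst 0) (IAdd (cell v) (IConst 1))) s1
    (set_nat s1 v k.+1) 6.
  have <- : ieval s1 (IAdd (cell v) (IConst 1)) = k.+1 by rewrite /= v1 addn1.
  exact: (ExecISet v (IConst 0)).
have [||s2 [t2 [e2 l2 I2]]] := IHm k.+1 _ _ kN' (stab _ _ k.+1 I1); first lia.
  by rewrite /= /update !eqxx.
eexists s2, _; split; last exact: I2.
  apply: ExecWhileTrue (ExecSeq e1 incr) e2.
  by rewrite /= (boundP _ _ Ik) vk addn1.
rewrite /=; lia.
Qed.

(** * The program *)

(* Memory layout.  Natural numbers and reals live in separate memories, so the
   same name may occur in both. *)
Local Notation n_var := 0%N (only parsing).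
Local Notation part_arr := 3%N (only parsing).
Local Notation mate_arr := 4%N (only parsing).
Local Notation outer_var := 5%N (only parsing).
Local Notation inner_var := 6%N (only parsing).
Local Notation item_var := 7%N (only parsing).
Local Notation lo_arr := 0%N (only parsing).
Local Notation up_arr := 1%N (only parsing).
Local Notation best_var := 4%N (only parsing).
Local Notation t1_var := 5%N (only parsing).
Local Notation t2_var := 6%N (only parsing).
Local Notation sum1_var := 7%N (only parsing).
Local Notation sum2_var := 8%N (only parsing).

Definition record_mate : cmd :=
  let i := cell outer_var in let k := cell inner_var in
  If (And (And (ILe (IGet part_arr i) (IGet part_arr k))
               (ILe (IGet part_arr k) (IGet part_arr i)))
          (Not (And (ILe i k) (ILe k i))))
    (ISet mate_arr i k) Skip.

Definition find_mates : cmd :=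
  For outer_var (cell n_var) (For inner_var (cell n_var) record_mate).

Definition find_mates_time (n : nat) : nat :=
  for_time (cell n_var) n (for_time (cell n_var) n (max_time record_mate)).

Definition Dev (i : iexp) : rexp := RSub (RGet up_arr i) (RGet lo_arr i).

Definition add_to (v : nat) (e : rexp) : cmd :=
  RSet v (IConst 0) (RAdd (rcell v) e).

Definition add_shares : cmd :=
  let a := cell item_var in let b := IGet mate_arr a in
  If (And (RLe (RGet lo_arr a) (RGet lo_arr b))
          (Not (And (RLe (RGet lo_arr b) (RGet lo_arr a)) (ILe b a))))
    (If (And (Not (RLe (Dev a) (rcell t1_var))) (Not (RLe (Dev a) (rcell t2_var))))
       (Seq (add_to sum2_var (RGet lo_arr b))
         (If (RLe (Dev b) (rcell t2_var)) (add_to sum1_var (RGet lo_arr a))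
         (If (RLe (Dev b) (rcell t1_var)) (add_to sum1_var (RGet lo_arr b))
            (add_to sum1_var (RGet up_arr b)))))
       (Seq (add_to sum1_var (RGet lo_arr a)) (add_to sum2_var (RGet lo_arr a))))
    Skip.

Definition init_sums : cmd :=
  Seq (RSet sum1_var (IConst 0) (rcell t1_var))
      (RSet sum2_var (IConst 0) (rcell t2_var)).

(** The value of the guess is left in the first sum. *)
Definition take_max : cmd :=
  If (RLe (rcell sum1_var) (rcell sum2_var))
    (RSet sum1_var (IConst 0) (rcell sum2_var)) Skip.

Definition eval_guess : cmd :=
  Seq init_sums (Seq (For item_var (cell n_var) add_shares) take_max).

Definition save_value : cmd := RSet best_var (IConst 0) (rcell sum1_var).

Definition set_thresholds : cmd :=
  Seq (RSet t1_var (IConst 0) (Dev (cell outer_var)))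
      (RSet t2_var (IConst 0) (Dev (cell inner_var))).

Definition zero_thresholds : cmd :=
  Seq (RSet t1_var (IConst 0) (RConst 0)) (RSet t2_var (IConst 0) (RConst 0)).

Definition keep_best : cmd :=
  If (RLe (rcell best_var) (rcell sum1_var)) Skip save_value.

Definition try_guess : cmd := Seq set_thresholds (Seq eval_guess keep_best).

Definition up_to_n : iexp := IAdd (cell n_var) (IConst 1).

(** The thresholds (0, 0) provide the initial value, which makes the program
    correct for n = 0 as well. *)
Definition solve : cmd :=
  Seq find_mates (Seq (Seq zero_thresholds (Seq eval_guess save_value))
    (For outer_var up_to_n (For inner_var up_to_n try_guess))).

(** * Correctness of the program *)

Section Correct.
Context {R : realType} {n l : nat}.
Variable I : instance R n l.
Hypotheses (I_wf : well_formed I) (I_pairs : forall j, #|part I j| = 2%N).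
Hypotheses (I_budget : Gamma I = 1%N).
Hypotheses (same_lo : c_lo I = d_lo I) (same_up : c_up I = d_up I).
Implicit Types s : state R.

Local Notation lo := (ord_array 0 (c_lo I 0)).
Local Notation up := (ord_array 0 (c_up I 0)).
Local Notation mate := (ord_array 0%N (fun i => mate_of I i : nat)).
Local Notation dev := (deviation lo up).
Local Notation guess := (guess_value n lo up mate).

Definition holds_costs s : Prop :=
  [/\ imem s n_var 0 = n, forall k, rmem s lo_arr k = lo k
    & forall k, rmem s up_arr k = up k].

Definition holds_mates s : Prop :=
  holds_costs s /\ forall k, (k < n)%N -> imem s mate_arr k = mate k.

(** The rows before [k] are complete and row [k] has been scanned up to [k'].
    As the partner is unique, a cell once filled is never overwritten. *)
Definition mates_found k k' s : Prop :=
  [/\ holds_costs s, forall k, imem s part_arr k = ord_array 0%N (part_of I) k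
    & forall i : 'I_n, (i < k)%N || (i == k :> nat) && (mate_of I i < k')%N ->
      imem s mate_arr i = mate_of I i].

Lemma find_mates_ok s :
    holds_costs s -> (forall k, imem s part_arr k = ord_array 0%N (part_of I) k) ->
  runs find_mates s (find_mates_time n) holds_mates.
Proof.
move=> costs parts; apply: (@runs_weaken _ _ _ _ (mates_found n 0)).
  apply: (runs_for (Inv := fun k => mates_found k 0)).
  - by move=> s' k [[]].
  - by [].
  - move=> s1 k kn Inv1 vk.
    apply: (@runs_weaken _ _ _ _ (fun s => mates_found k n s /\ imem s outer_var 0 = k)).
      apply: (runs_for (Inv := fun k' s => mates_found k k' s /\ imem s outer_var 0 = k)) => //.
      + by move=> s' k' [[[]]].
      + move=> s2 k' k'n [[cs ps ms] vk2] vk'.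
        apply: runs_loop_free => //=.
        rewrite vk2 vk' !ps.
        rewrite -eqn_leq -eqn_leq.
        have -> : ord_array 0%N (part_of I) k = part_of I (Ordinal kn).
          exact: (ord_arrayE _ _ (Ordinal kn)).
        have -> : ord_array 0%N (part_of I) k' = part_of I (Ordinal k'n).
          exact: (ord_arrayE _ _ (Ordinal k'n)).
        have := matchedE I_wf I_pairs (Ordinal kn) (Ordinal k'n).
        rewrite /matched -!val_eqE /= andbC eq_sym [(k' == k)%N]eq_sym => ->.
        case: ifPn => km.
          split=> //; split=> //; split=> // i; rewrite /= /update eqxx /=.
          case: eqVneq => [ik _|ik].
            by rewrite (eqP km) (_ : Ordinal kn = i) //; exact: val_inj.
          by rewrite orbF => ik'; rewrite ms // ik'.
        split=> //; split=> //; split=> // i.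
        rewrite ltnS => /orP[ik|/andP[/eqP ik]]; first by rewrite ms // ik.
        rewrite leq_eqVlt => /orP[/eqP ik'|ik']; last first.
          by rewrite ms // ik eqxx ik' orbT.
        have iE : Ordinal kn = i by apply: val_inj; rewrite /= ik.
        by move: km; rewrite iE ik' eqxx.
    move=> s2 [[cs ps ms] vk2]; split=> //; split=> // i.
    rewrite ltn0 andbF orbF ltnS leq_eqVlt => ik; rewrite ms // ltn_ord andbT orbC.
    exact: ik.
  by split=> // i; rewrite !ltn0 andbF.
move=> s' [cs _ ms]; split=> // k kn.
by rewrite (ms (Ordinal kn)) ?kn // -[k in RHS]/(val (Ordinal kn)) ord_arrayE.
Qed.

(** Evaluating a guess only writes to the arrays from [item_var] and [sum1_var]
    on; all inputs, thresholds and outer counters have smaller names. *)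
Definition keeps s s' : Prop :=
  (forall b k, (b < item_var)%N -> imem s' b k = imem s b k) /\
  (forall b k, (b < sum1_var)%N -> rmem s' b k = rmem s b k).

Lemma keeps_trans s1 s2 s3 : keeps s1 s2 -> keeps s2 s3 -> keeps s1 s3.
Proof.
by move=> [i12 r12] [i23 r23]; split=> b k bk; rewrite ?i23 ?i12 ?r23 ?r12.
Qed.

Lemma keeps_mates s s' : keeps s s' -> holds_mates s -> holds_mates s'.
Proof.
move=> [ki kr] [[nE loE upE] mE]; split; last by move=> k kn; rewrite ki // mE.
by split=> [|k|k]; rewrite ?ki ?kr.
Qed.

Lemma sum_nat_recr (P : pred nat) (f : nat -> R) k :
  \sum_(0 <= a < k.+1 | P a) f a =
  \sum_(0 <= a < k | P a) f a + (if P k then f k else 0).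
Proof. by rewrite big_mkcond big_nat_recr //= -big_mkcond. Qed.

Definition sums_upto t1 t2 k s : Prop :=
  rmem s sum1_var 0 = t1 +
    \sum_(0 <= a < k | cheaper lo mate a) struck_share lo up mate t1 t2 a /\
  rmem s sum2_var 0 = t2 +
    \sum_(0 <= a < k | cheaper lo mate a) waiting_share lo up mate t1 t2 a.

Lemma add_shares_ok s k t1 t2 : (k < n)%N -> holds_mates s ->
    imem s item_var 0 = k -> rmem s t1_var 0 = t1 -> rmem s t2_var 0 = t2 ->
    sums_upto t1 t2 k s ->
  let s' := denote add_shares s in
  [/\ keeps s s', sums_upto t1 t2 k.+1 s' & imem s' item_var 0 = k].
Proof.
move=> kn [[nE loE upE] mE] vk t1E t2E [sum1 sum2].
rewrite /sums_upto !sum_nat_recr /= !addrA -sum1 -sum2 /update /=.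
rewrite vk mE // !loE !upE t1E t2E.
rewrite /struck_share /waiting_share -!/(dev _) -negb_or -/(cheaper lo mate k) /=.
have low_keeps (r : nat -> nat -> R) :
    (forall b j, (b == sum1_var) = false -> (b == sum2_var) = false ->
      r b j = rmem s b j) ->
    keeps s (State (imem s) r).
  by move=> rs; split=> //= b j bj; apply: rs; rewrite ltn_eqF // (ltn_trans bj).
case: (cheaper lo mate k) => /=; last by rewrite !addr0; split.
case: (_ || _) => /=.
  by split=> //; apply: low_keeps => b j /= -> ->.
case: (_ <= t2) => /=.
  by split=> //; apply: low_keeps => b j /= -> ->.
by case: (_ <= t1) => /=; split=> //;
  apply: low_keeps => b j /= -> ->.
Qed.

Definition eval_guess_time (n : nat) : nat :=
  (max_time init_sums +
    (for_time (cell n_var) n (max_time add_shares) + max_time take_max).+1).+1.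

Lemma eval_guess_ok s : holds_mates s ->
  runs eval_guess s (eval_guess_time n) (fun s' => keeps s s' /\
    rmem s' sum1_var 0 = guess (rmem s t1_var 0) (rmem s t2_var 0)).
Proof.
move=> ms; set t1 := rmem s t1_var 0; set t2 := rmem s t2_var 0.
apply: (runs_seq (Q1 := fun s' => keeps s s' /\ sums_upto t1 t2 0 s')).
  apply: runs_loop_free => //=; split; last first.
    by rewrite /sums_upto !big_geq // !addr0.
  split=> // b j bj.
  by rewrite /= /update (ltn_eqF bj) ltn_eqF // (ltn_trans bj).
move=> s1 [k1 sums1]; apply: (runs_seq (Q1 := fun s' => keeps s s' /\ sums_upto t1 t2 n s')).
  apply: (runs_for (Inv := fun k s' => keeps s s' /\ sums_upto t1 t2 k s')) => //.
  - by move=> s' k [/keeps_mates /(_ ms) [[]]].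
  - move=> s' k j [[ki kr] sums]; split=> //; split=> // b j' bj.
    by rewrite /= /update (ltn_eqF bj) ki.
  - move=> s2 k kn [k2 sums2] vk; apply: runs_loop_free => //.
    have [_ kr] := k2.
    by have [/(keeps_trans k2)] :=
      add_shares_ok kn (keeps_mates k2 ms) vk (kr t1_var 0%N isT) (kr t2_var 0%N isT) sums2.
move=> s2 [k2 [sum1 sum2]]; apply: runs_loop_free => //=.
rewrite /guess_value -sum1 -sum2.
case: (lerP (rmem s2 sum1_var 0) (rmem s2 sum2_var 0)) => le12; last by split.
split=> //; apply: keeps_trans k2 _; split=> // b j bj.
by rewrite /= /update (ltn_eqF bj).
Qed.

(** The best value found is the value of some guess, hence an upper bound of
    [Rob], and it is at most the value of each guess tried so far. *)
Definition best_upto i j s : Prop :=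
  [/\ holds_mates s,
      exists t1 t2, [/\ 0 <= t1, 0 <= t2 & rmem s best_var 0 = guess t1 t2]
    & forall a b, (b <= n)%N -> (a < i)%N || (a == i) && (b < j)%N ->
      rmem s best_var 0 <= guess (dev a) (dev b)].

Definition try_guess_time (n : nat) : nat :=
  (max_time set_thresholds + (eval_guess_time n + max_time keep_best).+1).+1.

Lemma try_guess_ok s i j : best_upto i j s ->
    imem s outer_var 0 = i -> imem s inner_var 0 = j ->
  runs try_guess s (try_guess_time n) (fun s' =>
    [/\ best_upto i j.+1 s', imem s' outer_var 0 = i & imem s' inner_var 0 = j]).
Proof.
move=> [ms fair best] vi vj; have [[nE loE upE] mE] := ms.
pose s0 := denote set_thresholds s.
have ms0 : holds_mates s0 by [].
have t1E : rmem s0 t1_var 0 = dev i by rewrite /= /update /= vi loE upE.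
have t2E : rmem s0 t2_var 0 = dev j by rewrite /= /update /= vj loE upE.
apply: (runs_seq (Q1 := eq s0)); first exact: runs_loop_free.
move=> _ <-; apply: runs_seq; first exact: eval_guess_ok ms0.
move=> s1 [k1]; rewrite t1E t2E => valE; have [ki kr] := k1.
have best1 : rmem s1 best_var 0 = rmem s best_var 0 by rewrite kr.
have ms1 := keeps_mates k1 ms0; apply: runs_loop_free => //=.
rewrite valE best1; case: (lerP (rmem s best_var 0) (guess (dev i) (dev j))) => cmp.
  split; rewrite ?ki //; split=> //; rewrite best1 // => a b bn.
  rewrite ltnS [(b <= j)%N]leq_eqVlt andb_orr orbCA => /orP[/andP[/eqP-> /eqP->] //|].
  exact: best.
split; rewrite /= ?ki //; split=> //=; rewrite /update /= ?valE.
  by exists (dev i), (dev j); split=> //; exact: dev_nat_ge0.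
move=> a b bn; rewrite ltnS [(b <= j)%N]leq_eqVlt andb_orr orbCA.
move=> /orP[/andP[/eqP-> /eqP->] //|/(best _ _ bn)].
by apply: le_trans; exact: ltW.
Qed.

Definition solve_time (n : nat) : nat :=
  (find_mates_time n + ((max_time zero_thresholds +
      (eval_guess_time n + max_time save_value).+1).+1 +
    for_time up_to_n n.+1 (for_time up_to_n n.+1 (try_guess_time n))).+1).+1.

Lemma solve_ok : runs solve (encode I) (solve_time n)
  (fun s => Rob I = (output s)%:E).
Proof.
apply: runs_seq; first exact: find_mates_ok.
move=> s1 ms1; apply: (runs_seq (Q1 := best_upto 0 0)).
  pose s0 := denote zero_thresholds s1.
  apply: (runs_seq (Q1 := eq s0)); first exact: runs_loop_free.
  move=> _ <-; have ms0 : holds_mates s0 by [].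
  apply: runs_seq; first exact: eval_guess_ok ms0.
  move=> s2 [k2 valE]; apply: runs_loop_free => //; split=> //=.
  - exact: keeps_mates k2 ms0.
  - by exists 0, 0.
  - by move=> a b _; rewrite !ltn0 andbF.
move=> s2 best2; apply: (@runs_weaken _ _ _ _ (best_upto n.+1 0)); last first.
  move=> s3 [_ [t1 [t2 [t1_ge0 t2_ge0 outE]]] best]; apply/eqP; rewrite eq_le /output.
  rewrite {1}outE Rob_le_guess //= le_Rob // => a b an bn.
  by apply: best => //; rewrite ltnS an.
apply: (runs_for (Inv := fun i => best_upto i 0)) => //.
- by move=> s3 k [[[nE _ _] _] _ _]; rewrite /= nE addn1.
- move=> s3 i _ best3 vi.
  apply: (@runs_weaken _ _ _ _ (fun s => best_upto i n.+1 s /\ imem s outer_var 0 = i)).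
    apply: (runs_for (Inv := fun j s => best_upto i j s /\ imem s outer_var 0 = i)) => //.
    + by move=> s4 k [[[[nE _ _] _] _ _] _]; rewrite /= nE addn1.
    + move=> s4 j _ [best4 vi4] vj; apply: (runs_weaken (try_guess_ok best4 vi4 vj)).
      by move=> s5 [].
  move=> s4 [[ms fair best] vi4]; split=> //; split=> // a b bn.
  rewrite ltn0 andbF orbF ltnS leq_eqVlt orbC => ai; apply: best => //.
  by rewrite ltnS bn andbT.
Qed.

End Correct.

(** * Running time *)

Lemma bigO_cst c e : bigO_nat (fun=> c) (expn^~ e).
Proof. by exists c, 1%N => n n_gt0; rewrite leq_pmulr // expn_gt0 n_gt0. Qed.

Lemma bigO_seq f g e1 e2 e : (e1 <= e)%N -> (e2 <= e)%N ->
    bigO_nat f (expn^~ e1) -> bigO_nat g (expn^~ e2) ->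
  bigO_nat (fun n => (f n + g n).+1) (expn^~ e).
Proof.
move=> le1 le2 [C1 [N1 f_le]] [C2 [N2 g_le]].
exists (C1 + C2).+1, (maxn 1 (maxn N1 N2)) => n.
rewrite !geq_max => /andP[n_gt0 /andP[/f_le fn /g_le gn]].
have pow_le e' : (e' <= e)%N -> (n ^ e' <= n ^ e)%N by exact: leq_pexp2l.
rewrite mulSn mulnDl -add1n leq_add ?expn_gt0 ?n_gt0 // leq_add //.
- by rewrite (leq_trans fn) // leq_mul2l pow_le ?orbT.
- by rewrite (leq_trans gn) // leq_mul2l pow_le ?orbT.
Qed.

Lemma bigO_for bound N f e : (forall n, (N n <= n.+1)%N) ->
    bigO_nat f (expn^~ e) ->
  bigO_nat (fun n => for_time bound (N n) (f n)) (expn^~ e.+1).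
Proof.
move=> N_le [C [N0 f_le]]; exists (3 * (C + itime bound + 13))%N, (maxn 1 N0) => n.
rewrite geq_max => /andP[n_gt0 /f_le fn].
rewrite /for_time expnS mulnACA leq_mul //.
  by have := N_le n; lia.
rewrite -addnA -[(C + _ + _)%N]addnA mulnDl leq_add //.
by rewrite leq_pmulr // expn_gt0 n_gt0.
Qed.

Lemma solve_time_cubic : bigO_nat solve_time (expn^~ 3).
Proof.
have eval_linear : bigO_nat eval_guess_time (expn^~ 1).
  apply: (bigO_seq (e1 := 0) (e2 := 1)) => //; first exact: bigO_cst.
  apply: (bigO_seq (e1 := 1) (e2 := 0)) => //; last exact: bigO_cst.
  by apply: bigO_for => //; exact: bigO_cst.
apply: (bigO_seq (e1 := 2) (e2 := 3)) => //.
  by apply: bigO_for => //; apply: bigO_for => //; exact: bigO_cst.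
apply: (bigO_seq (e1 := 1) (e2 := 3)) => //.
  apply: (bigO_seq (e1 := 0) (e2 := 1)) => //; first exact: bigO_cst.
  by apply: (bigO_seq (e1 := 1) (e2 := 0)) => //; exact: bigO_cst.
apply: bigO_for => //; apply: bigO_for => //.
apply: (bigO_seq (e1 := 0) (e2 := 1)) => //; first exact: bigO_cst.
by apply: (bigO_seq (e1 := 1) (e2 := 0)) => //; exact: bigO_cst.
Qed.

Theorem theorem21 :
  solvable_in_bigO
    (fun (R : realType) (n l : nat) (I : instance R n l) =>
      [/\ well_formed I,
          (forall j : 'I_l, #|part I j| = 2%N),
          Gamma I = 1%N,
          c_lo I = d_lo I
        & c_up I = d_up I])
    (fun n : nat => (n ^ 3)%N).
Proof.
exists solve, solve_time; split; first exact: solve_time_cubic.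
move=> R n l I [I_wf I_pairs I_budget same_lo same_up].
exact: solve_ok.
Qed.
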